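(* Assume that $\mathbb{K}=\mathbb{Q}$ or $\mathbb{K}=\mathbb{R}$. For the Fock space action of $\mathbf{U}_\upsilon(\mathfrak{sl}(S^1_{\mathbb{K}}))$ on $\mathcal{F}_{\mathbb{K}}$ we have $$(\mathcal{F}_{\mathbb{K}})^{\mathbf{U}^+_\upsilon(\mathfrak{sl}(S^1_{\mathbb{K}}))}=F\,|0\rangle ,$$ i.e. the vectors $v\in\mathcal{F}_{\mathbb{K}}$ with $E_Jv=0$ for all strict intervals $J$ of $S^1_{\mathbb{K}}$ are exactly the scalar multiples of $|0\rangle$.
   Context: Ground field: $F=\mathbb{Q}(\upsilon^{1/2})$. $S^1_{\mathbb{K}}=\mathbb{K}/\mathbb{Z}$, with projection $\pi_{\mathbb{K}}$. Step functions. $\mathbb{F}(\mathbb{K})$ is the set of right-continuous piecewise constant functions $f:\mathbb{R}\to\mathbb{Z}$ with bounded support and finitely many discontinuities, all in $\mathbb{K}$. A $\mathbb{K}$-interval is $[a,b[$ with $a<b$ in $\mathbb{K}$; $\mathbf 1_I$ is the characteristic function of $I$. With $h_\pm(x)=\lim_{t\to0,t>0}h(x\pm t)$ put $\langle f,g\rangle=\sum_x f_-(x)(g_-(x)-g_+(x))$. Pyramids. A $\mathbb{K}$-pyramid is $p\in\mathbb{F}(\mathbb{K})$ with values in $\mathbb{N}$ such that $p(0)=\max p$, $p$ is weakly increasing on $x\le0$ and weakly decreasing on $x\ge0$, and $|p_+(x)-p_-(x)|\le1$ for all $x$. $\mathsf{Pyr}(\mathbb{K})$ is the set of $\mathbb{K}$-pyramids;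 $0$ is the zero pyramid; $\mathcal{F}_{\mathbb{K}}=\bigoplus_{p\in\mathsf{Pyr}(\mathbb{K})}F|p\rangle$. A $\mathbb{K}$-interval $I$ is addable to (resp. removable from) $p$ if $p+\mathbf 1_I$ (resp. $p-\mathbf 1_I$) is a $\mathbb{K}$-pyramid. $n_I(p)=1,-1,0$ according to whether $I$ is addable, removable, neither. With $\tau_m([a,b[)=[a+m,b+m[$: $n^<_I(p)=\sum_{m\ge1}n_{\tau_{-m}(I)}(p)$. For $I=[a,b[$, $I'=[c,d[$ write $I<I'$ if $b<c$. Intervals of the circle $S^1_{\mathbb{K}}$ are images of $\mathbb{K}$-intervals $[a,b[$ with $b-a\le1$; strict means not the whole circle; $J\to J'$ means $J\cap J'=\emptyset$, $\overline J\cap J'\neq\emptyset$, and $J\cup J'$ is an interval. $\mathbf{U}_\upsilon(\mathfrak{sl}(S^1_{\mathbb{K}}))$ is the circle quantum group, generated by $E_J,F_J$ ($J$ strict) and $K_J^{\pm1}$ ($J$ any interval); $\mathbf{U}^+_\upsilon(\mathfrak{sl}(S^1_{\mathbb{K}}))$ is the subalgebra generated by the $E_J$. In the Fock space action, the operators $E_J$ (the only part needed here) are given by the finite sums $$E_J|p\rangle=\sum(-\upsilon^{1/2})^{\ell}\upsilon^{\frac{\ell-1}{2}-\sum_i n^<_{J'_i}(p)}(-\upsilon)^{-\sum_i\langle\mathbf 1_{J'_i},p\rangle}(\upsilon-\upsilon^{-1})^{\ell-1}\Big|p-\sum_i\mathbf 1_{J'_i}\Big\rangle,$$ over all tuples ($\ell\ge1$)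 of $\mathbb{K}$-intervals removable from $p$ with $J'_1>\cdots>J'_\ell$, $\pi_{\mathbb{K}}(J'_1)\to\cdots\to\pi_{\mathbb{K}}(J'_\ell)$ and $\pi_{\mathbb{K}}(J'_1)\sqcup\cdots\sqcup\pi_{\mathbb{K}}(J'_\ell)=J$. *)

(* Defs.v *)
From HB Require Import structures.
From mathcomp Require Import all_boot all_order all_algebra.
From mathcomp Require Import finmap.
From mathcomp Require Import all_classical all_reals all_analysis.
From mathcomp Require Import (canonicals) monalg.

Set Implicit Arguments.
Unset Strict Implicit.
Unset Printing Implicit Defensive.

Import Order.TTheory GRing.Theory Num.Theory.
Import numFieldNormedType.Exports.

Local Open Scope classical_set_scope.
Local Open Scope ring_scope.
Local Open Scope quotient_scope.

(* Q(v^(1/2)) is the field of rational functions in vhalf = v^(1/2). *)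
Definition baseF : fieldType := {fraction {poly rat}}.
Definition vhalf : baseF := FracField.tofrac ('X : {poly rat}).
Definition vv : baseF := vhalf ^+ 2.

(* Step functions take values in the discrete space of integers. *)
Definition dint : Type := discrete_topology int.
HB.instance Definition _ := DiscreteTopology.on dint.
HB.instance Definition _ := isPointed.Build dint (0 : int).

Section StepFunctions.
Context {R : realType}.
Implicit Types (K : set R) (f g p : R -> int).

Definition rlim f (x : R) : int := lim ((f t : dint) @[t --> x^'+]).
Definition llim f (x : R) : int := lim ((f t : dint) @[t --> x^'-]).

Definition discontinuities f : set R :=
  [set x | ~ {for x, continuous (f : R -> dint)}].

(* Piecewise constancy is implied: a continuous function from an interval to
   the discrete space of integers is constant. *)
Definition step_function K f : Prop :=
  [/\ forall x : R, (f t : dint) @[t --> x^'+] --> (f x : dint),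
      bounded_set [set x | f x != 0],
      finite_set (discontinuities f) &
      discontinuities f `<=` K].

Definition pairing f g : int :=
  \sum_(x \in [set: R]) llim f x * (llim g x - rlim g x).

Definition pyramid K : set (R -> int) :=
  [set p | [/\ step_function K p,
    forall x : R, 0 <= p x <= p 0,
    forall x y : R, x <= y -> y <= 0 -> p x <= p y,
    forall x y : R, 0 <= x -> x <= y -> p y <= p x &
    forall x : R, `|rlim p x - llim p x| <= 1]].

Lemma pyramid0 K : pyramid K (fun _ => 0).
Proof.
have disc0 : discontinuities (fun _ : R => 0 : int) = set0.
  by apply/seteqP; split=> // x; apply; exact: cvg_cst.
split=> //; last by move=> x; rewrite /rlim /llim !(lim_cst discrete_hausdorff).
split; rewrite ?disc0 //; first by move=> x; exact: cvg_cst.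
by exists 0; split=> // M _ x /=; rewrite eqxx.
Qed.

(* The pair (a, b) stands for the interval [a, b[. *)
Definition Kinterval K : set (R * R) :=
  [set I | [/\ K I.1, K I.2 & I.1 < I.2]].

Definition char_fun (I : R * R) : R -> int := \1_(`[I.1, I.2[%classic).

Definition addable K (I : R * R) p : Prop :=
  Kinterval K I /\ pyramid K (p \+ char_fun I).

Definition removable K (I : R * R) p : Prop :=
  Kinterval K I /\ pyramid K (p \- char_fun I).

Definition n_ K (I : R * R) p : int :=
  if `[< addable K I p >] then 1 else if `[< removable K I p >] then -1 else 0.

Definition shift (m : R) (I : R * R) : R * R := (I.1 + m, I.2 + m).

(* A sum with finite support: shifting far to the left makes I neither addable
   nor removable. *)
Definition n_lt K (I : R * R) p : int :=
  \sum_(m \in [set m : nat | (1 <= m)%N]) n_ K (shift (- m%:R) I) p.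

Definition interval_lt (I I' : R * R) : bool := I.2 < I'.1.

End StepFunctions.

Section Circle.
Context {R : realType} (K : set R).

Definition mod_int (x y : K) : bool := \val x - \val y \is a Num.int.

Lemma mod_int_refl : reflexive mod_int.
Proof. by move=> x; rewrite /mod_int subrr rpred0. Qed.

Lemma mod_int_sym : symmetric mod_int.
Proof. by move=> x y; rewrite /mod_int -opprB rpredN. Qed.

Lemma mod_int_trans : transitive mod_int.
Proof.
move=> y x z; rewrite /mod_int => xy yz.
by rewrite -(subrK (\val y) (\val x)) -addrA rpredD.
Qed.

Canonical mod_int_equiv : equiv_rel K :=
  EquivRel mod_int mod_int_refl mod_int_sym mod_int_trans.

(* K / Z, with the quotient of the topology induced by R on K. *)
Definition circle : topologicalType :=
  quotient_topology {eq_quot mod_int_equiv}.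

Definition circle_proj (x : K) : circle := \pi_{eq_quot mod_int_equiv} x.

Definition circle_image (I : R * R) : set circle :=
  [set circle_proj x | x in [set x : K | I.1 <= \val x < I.2]].

Definition circle_interval (J : set circle) : Prop :=
  exists I : R * R, [/\ Kinterval K I, I.2 - I.1 <= 1 & J = circle_image I].

Definition strict_interval (J : set circle) : Prop :=
  circle_interval J /\ J <> setT.

Definition circle_next (J J' : set circle) : Prop :=
  [/\ J `&` J' = set0, closure J `&` J' !=set0 & circle_interval (J `|` J')].

End Circle.

Arguments circle_image {R} K I _.

Section FockSpace.
Context {R : realType} (K : set R).

(* Finitely supported functions from the set of K-pyramids to baseF. *)
Definition Fock : lmodType baseF := monalg.malg (pyramid K) baseF.

(* |p>, with the convention |p> = 0 when p is not a K-pyramid. *)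
Definition ket (p : R -> int) : Fock :=
  if insub p is Some q then monalg.mkmalgU q 1 else 0.

(* The tuples (J'_1, ..., J'_l) indexing the sum that defines E_J |p>. *)
Definition E_index (J : set (circle K)) (p : R -> int)
    : set (seq (R * R)) :=
  [set s | [/\ (0 < size s)%N,
    forall I : R * R, I \in s -> removable K I p,
    sorted (fun I I' => interval_lt I' I) s,
    sorted (fun I I' => `[< circle_next (circle_image K I) (circle_image K I') >]) s &
    trivIset [set i | (i < size s)%N]
      (fun i => circle_image K (nth (0, 0) s i)) /\
    \bigcup_(i in [set i | (i < size s)%N]) circle_image K (nth (0, 0) s i) = J]].

(* v^((l - 1) / 2 - N) is written vhalf^(l - 1) * v^(-N). *)
Definition E_coeff (p : R -> int) (s : seq (R * R)) : baseF :=
  (- vhalf) ^+ size s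
  * (vhalf ^+ (size s).-1 * vv ^ (- \sum_(I <- s) n_lt K I p))
  * (- vv) ^ (- \sum_(I <- s) pairing (char_fun I) p)
  * (vv - vv^-1) ^+ (size s).-1.

(* A sum with finite support: although p may have infinitely many removable
   intervals, only finitely many tuples of them project onto the fixed J. *)
Definition E_ket (J : set (circle K)) (p : R -> int) : Fock :=
  \sum_(s \in E_index J p)
     E_coeff p s *: ket (p \- (fun x => \sum_(I <- s) char_fun I x)).

Definition E_op (J : set (circle K)) (v : Fock) : Fock :=
  \sum_(p <- monalg.msupp v) monalg.mcoeff p v *: E_ket J (\val p).

(* The invariants of the subalgebra generated by the E_J, J strict. *)
Definition Uplus_invariants : set Fock :=
  [set v | forall J, strict_interval J -> E_op J v = 0].

End FockSpace.

Arguments Uplus_invariants {R} K _.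

(* Main.v *)
Require Import Defs.
From HB Require Import structures.
From mathcomp Require Import all_boot all_order all_algebra.
From mathcomp Require Import all_classical all_reals all_analysis.
From mathcomp Require Import finmap zify lra.
From mathcomp Require Import (canonicals) monalg.

(** A nonzero pyramid p has a last step down, at some b > 0 in K, and takes the
    value 1 on an interval just to the left of b. Given a vector v whose support
    contains p, choose a < b in K so close to b that p is 1 from a to b and that
    no discontinuity of a pyramid in the support of v lies in [a, b[ modulo 1;
    this is possible because K accumulates at b from the left and only finitely
    many discontinuities are involved. Take for J the arc image of [a, b[.

    An interval removable from a pyramid has an endpoint at a discontinuity of
    that pyramid ([removable_discontinuity]). By the choice of a, an interval
    removable from a pyramid of the support and projecting into J must therefore
    end at a translate of b. Two such intervals have overlapping images, so the
    tuples that define the action of E_J on this pyramid are the singletons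
    [a + m, b + m[ with m an integer ([E_index_arc]): E_J just moves one step
    from b + m to a + m. As no pyramid of the support has a step at a translate
    of a, the result shows which step was moved: removing [a + m, b + m[ from a
    pyramid of the support gives the same result as removing [a, b[ from p only
    if m = 0 ([removed_arc_inj]), and then that pyramid is p. Hence the pyramid
    obtained from p by removing [a, b[ occurs in E_J v exactly once, with a
    nonzero coefficient, and v is not invariant ([E_op_neq0]).

    Conversely nothing is removable from the zero pyramid, as this would
    produce a negative value, so every E_J kills the vacuum. *)

Set Implicit Arguments.
Unset Strict Implicit.
Unset Printing Implicit Defensive.

Import Order.TTheory GRing.Theory Num.Theory.
Import numFieldNormedType.Exports.

Local Open Scope classical_set_scope.
Local Open Scope ring_scope.

(** * Integer-valued functions with the discrete topology *)

Lemma cvg_dintP (T : Type) (F : set_system T) {FF : Filter F}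
    (f : T -> int) (c : int) :
  ((f t : dint) @[t --> F] --> (c : dint)) <-> \forall t \near F, f t = c.
Proof.
split=> [|fc]; last exact: cvg_near_cst.
move=> /(_ [set c]); apply; rewrite nbhs_principalE.
by apply/principal_filterP.
Qed.

Lemma continuous_dintP (R : realType) (f : R -> int) (x : R) :
  {for x, continuous (f : R -> dint)} <-> \forall t \near x, f t = f x.
Proof. exact: cvg_dintP. Qed.

Lemma lim_dint (T : Type) (F : set_system T) {FF : ProperFilter F}
    (f : T -> int) (c : int) :
  (\forall t \near F, f t = c) -> lim ((f t : dint) @[t --> F]) = c.
Proof.
by move=> /cvg_dintP fc; apply: cvg_lim => //; exact: discrete_hausdorff.
Qed.

Lemma lim_dint_eq (T : Type) (F : set_system T) {FF : ProperFilter F}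
    (f g : T -> int) : (\forall t \near F, f t = g t) ->
  lim ((f t : dint) @[t --> F]) = lim ((g t : dint) @[t --> F]).
Proof.
move=> fg; congr (lim _); apply/seteqP; split=> A /= FA.
  by apply: filterS2 fg FA => t /= ->.
by apply: filterS2 fg FA => t /= <-.
Qed.

(** * Pyramids *)

Lemma char_funE (R : realType) (I : R * R) (x : R) :
  char_fun I x = (I.1 <= x < I.2)%R%:R.
Proof. by rewrite /char_fun indicE mem_setE in_itv. Qed.

(** If I.1 <= 0, the removal of I lowers the value at I.1 below the values just
    before it unless p jumps there, against the growth of pyramids left of 0.
    Otherwise I lies right of 0, and the removal lowers the values just before
    I.2 below the value at I.2 unless p jumps there. *)
Lemma removable_discontinuity (R : realType) (K : set R) (I : R * R) p :
  removable K I p ->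
  discontinuities p I.1 \/ discontinuities p I.2.
Proof.
case: I => a b [[/= Ka Kb ab]] [_ _ up down _].
have [a0|a0] := leP a 0; [left|right] => /continuous_dintP ctn.
- have [t ta pt] : exists2 t, t < a & p t = p a.
    suff : \forall t \near a^'-, t < a /\ p t = p a.
      by move=> /filter_ex[t []]; exists t.
    near=> t; split; first by near: t; exact: nbhs_left_lt.
    by near: t; exact: (cvg_within _ ctn).
  have /= := up t a (ltW ta) a0; rewrite !char_funE /=.
  by rewrite pt lexx ab (lt_geF ta) /=; lia.
- have [t /andP[ta tb] pt] : exists2 t, a < t < b & p t = p b.
    suff : \forall t \near b^'-, a < t < b /\ p t = p b.
      by move=> /filter_ex[t []]; exists t.
    near=> t; split; last by near: t; exact: (cvg_within _ ctn).
    by apply/andP; split; near: t; [exact: nbhs_left_gt|exact: nbhs_left_lt].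
  have /= := down t b (ltW (lt_trans a0 ta)) (ltW tb).
  by rewrite !char_funE /= pt ltxx tb (ltW ta) andbF /=; lia.
Unshelve. all: by end_near. Qed.

(** The end b is the supremum of the support. Monotonicity makes p constant and
    positive just before b, and the bound on the jump at b makes it 1. *)
Lemma pyramid_right_end (R : realType) (K : set R) (p : R -> int) :
    pyramid K p -> p <> (fun=> 0) ->
  exists x b : R, [/\ 0 <= x < b, K b, forall t, b <= t -> p t = 0 &
                      forall t, x <= t < b -> p t = 1].
Proof.
move=> [[rc bd fin dK] ge0 up down jump] p_neq0.
have p0 : 0 < p 0.
  rewrite lt_neqAle (andP (ge0 0)).1 andbT; apply/eqP => p00; apply: p_neq0.
  by apply/funext => x; have := ge0 x; lia.
pose S := [set x | 0 < p x].
have S0 : S 0 by [].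
have supS : has_sup S.
  split; first by exists 0.
  have [M [_ SM]] := bd; exists (M + 1) => x Sx.
  apply: le_trans (ler_norm x) _; apply: SM; first by rewrite ltrDl.
  by rewrite /= gt_eqF.
pose b := sup S.
have b_ge0 : 0 <= b by apply: ub_le_sup => //; exact: supS.2.
have pr t : b < t -> p t = 0.
  move=> bt; apply/eqP; rewrite eq_le (andP (ge0 t)).1 andbT leNgt.
  by apply/negP => pt; have := ub_le_sup supS.2 pt; rewrite leNgt bt.
have pb : p b = 0.
  have /cvg_dintP pbt := rc b.
  have : \forall t \near b^'+, b < t /\ p t = p b.
    near=> t; split; near: t; [exact: nbhs_right_gt|exact: pbt].
  by case/filter_ex => t [/pr -> ->].
have pl t : 0 <= t -> t < b -> 0 < p t.
  move=> t0 tb; have [y Sy ty] := sup_gt (ex_intro _ _ S0) tb.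
  exact: lt_le_trans Sy (down t y t0 (ltW ty)).
have b_gt0 : 0 < b.
  by rewrite lt_neqAle b_ge0 andbT; apply: contraTneq p0 => ->; rewrite pb.
(* Induction on a bound for p y: from y on, p can only drop finitely often
   before b, since it stays positive there. *)
have [x /andP[x0 xb] px] :
    exists2 x, 0 <= x < b & forall t, x <= t < b -> p t = p x.
  suff : forall n y, 0 <= y < b -> p y <= n%:Z ->
      exists2 x, 0 <= x < b & forall t, x <= t < b -> p t = p x.
    by move=> /(_ `|p 0%R|%N 0); apply; rewrite ?lexx // gez0_abs // ltW.
  elim=> [|n IH] y /andP[y0 yb] pyn; first by have := pl y y0 yb; lia.
  have [[t /andP[yt tb] pt]|H] := pselect (exists2 t, y <= t < b & p t != p y).
    have := down y t y0 yt; move=> tley; apply: (IH t).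
      by rewrite (le_trans y0 yt).
    by move: pt tley pyn; lia.
  exists y; first by rewrite y0.
  by move=> t ytb; apply/eqP/negPn/negP => pt; apply: H; exists t.
have ctl : \forall t \near b^'-, p t = p x.
  near=> t; apply: px; apply/andP; split; near: t.
    exact: nbhs_left_ge.
  exact: nbhs_left_lt.
have px_gt0 := pl x x0 xb.
have px1 : p x = 1.
  have := jump b; rewrite /llim /rlim (lim_dint ctl) (@lim_dint _ _ _ _ 0).
    by lia.
  by near=> t; apply: pr; near: t; exact: nbhs_right_gt.
exists x, b; split=> [||t|t /px ->//]; first by rewrite x0.
- apply: dK => /continuous_dintP ctn.
  near (b^'-) => t.
  have pt : p t = p x by near: t.
  have : p t = p b by near: t; exact: (cvg_within _ ctn).
  by rewrite pt px1 pb.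
- by rewrite le_eqVlt => /predU1P[<-|/pr].
Unshelve. all: by end_near. Qed.

(** Removing [a, b[ amounts to cutting p off at a, that is, to moving the last
    step down from b to a. *)
Lemma pyramid_truncate (R : realType) (K : set R) (p : R -> int) (x a b : R) :
    pyramid K p -> 0 <= x -> x < a -> a < b -> K a ->
    (forall t, b <= t -> p t = 0) -> (forall t, x <= t < b -> p t = 1) ->
  pyramid K (p \- char_fun (a, b)).
Proof.
move=> [[rc [M [Mr bd]] fin dK] ge0 up down jump] x0 xa ab Ka pr p1.
set q := _ \- _.
have qE t : q t = if t < a then p t else 0.
  rewrite /q /= char_funE /=; case: (ltP t a) => ta; first by rewrite subr0.
  case: (ltP t b) => tb; last by rewrite pr // subr0.
  by rewrite p1 ?subrr // tb (le_trans (ltW xa) ta).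
have a0 : 0 < a := le_lt_trans x0 xa.
have ql t : t < a -> \forall s \near t, q s = p s.
  by move=> ta; near=> s; rewrite qE ifT //; near: s; exact: lt_nbhsl.
have qr t : a < t -> \forall s \near t, q s = 0.
  move=> ta; near=> s; rewrite qE ltNge ifF //; apply/negbTE; rewrite negbK.
  by apply: ltW; near: s; exact: lt_nbhsr.
have qa : \forall s \near a^'+, q s = 0.
  near=> s; rewrite qE ltNge ltW //=; near: s; exact: nbhs_right_gt.
have dq : discontinuities q `<=` discontinuities p `|` [set a].
  move=> t dqt.
  have [ta|ta|->] := ltgtP t a; [left=> /continuous_dintP ctn| |by right].
    apply: dqt; apply/continuous_dintP; rewrite qE ta.
    by apply: filterS2 (ql t ta) ctn => s -> ->.
  case: dqt; apply/continuous_dintP; rewrite qE ltNge ltW //=; exact: qr.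
split.
- split.
  + move=> t; apply/cvg_dintP; rewrite qE; case: (ltgtP t a) => ta.
    * have /cvg_dintP pt := rc t.
      near=> s; have -> : q s = p s by near: s; exact: (cvg_within _ (ql t ta)).
      by near: s.
    * exact: (cvg_within _ (qr t ta)).
    * by rewrite ta.
  + exists M; split=> // N MN t /=; rewrite qE; case: ifP => // _; exact: bd.
  + by apply: sub_finite_set dq _; rewrite finite_setU.
  + by move=> t /dq[/dK//|->].
- move=> t; rewrite !qE a0; case: ifP => _; first exact: ge0.
  by rewrite lexx (andP (ge0 0)).1.
- move=> s t st t0; rewrite !qE !ifT ?up//; [exact: le_lt_trans a0|].
  exact: le_lt_trans st (le_lt_trans t0 a0).
- move=> s t s0 st; rewrite !qE; case: (ltP t a) => ta.
    by rewrite (le_lt_trans st ta); exact: down.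
  by case: ifP => // _; exact: (andP (ge0 s)).1.
- move=> t; have [ta|ta|->] := ltgtP t a.
  + rewrite /rlim /llim (@lim_dint_eq _ _ _ q p) ?(@lim_dint_eq _ _ _ q p) //;
      [exact: jump|exact: (cvg_within _ (ql t ta))..].
  + rewrite /rlim /llim !(@lim_dint _ _ _ q 0) //;
      exact: (cvg_within _ (qr t ta)).
  + rewrite /rlim /llim (lim_dint qa) (@lim_dint _ _ _ q 1) //.
    near=> s.
    have sa : s < a by near: s; exact: nbhs_left_lt.
    have xs : x <= s by near: s; exact: nbhs_left_ge.
    by rewrite qE sa p1 // xs (lt_trans sa ab).
Unshelve. all: by end_near. Qed.

(** * Arcs of the circle *)

Definition translation_stable (R : realType) (K : set R) : Prop :=
  forall (x : R) (m : int), K x -> K (x + m%:~R).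

Lemma circle_imageP (R : realType) (K : set R) (I : R * R) (x : K) :
  translation_stable K ->
  circle_image K I (circle_proj x) <->
    exists m : int, I.1 <= \val x + m%:~R < I.2.
Proof.
move=> Kper; split=> [[y /= Iy /eqmodP]|[m Ixm]].
  by move=> /intrP[m yxm]; exists m; rewrite -yxm addrC subrK.
have Kxm : \val x + m%:~R \in K by apply/mem_set/Kper/set_valP.
exists (SigSub Kxm : K) => //=; apply/eqmodP.
by apply/intrP; exists m; rewrite /= addrC addKr.
Qed.

Lemma circle_arc_strict (R : realType) (K : set R) (a b : R) :
  translation_stable K -> K a -> K b -> a < b -> b - a < 1 ->
  strict_interval (circle_image K (a, b)).
Proof.
move=> Kper Ka Kb ab ba1; split.
  by exists (a, b); split=> //; exact: ltW.
move=> /seteqP[_ /(_ (circle_proj (SigSub (mem_set Kb) : K)) Logic.I)].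
move=> /(circle_imageP _ _ Kper)[m /= /andP[am mb]].
have m0 : m < 0 by rewrite -(ltrz0 R); lra.
have : m%:~R <= (-1)%:~R :> R by rewrite ler_int; lia.
by rewrite mulrN1z; lra.
Qed.

Lemma le_of_intr_sub_lt1 (R : realType) (m n : int) :
  m%:~R - n%:~R < 1 :> R -> m <= n.
Proof. by rewrite ltrBlDl -(intrD _ n 1) ltr_int; lia. Qed.

Definition avoids_translates (R : realType) (a b : R) (D : set R) : Prop :=
  forall (x : R) (m : int), D x -> ~ a <= x + m%:~R < b.

(** * Removable intervals above a generic arc *)

Section Arc.
Variables (R : realType) (K : set R) (a b : R).
Hypotheses (Kper : translation_stable K) (Ka : K a) (Kb : K b).
Hypotheses (ab : a < b) (ba1 : b - a < 1).

(** The left endpoint lies above the arc, hence is no discontinuity of p; so the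
    right endpoint is one, and it can only sit at a translate of b. *)
Lemma removable_in_arc (p : R -> int) (I : R * R) :
  avoids_translates a b (discontinuities p) -> removable K I p ->
  circle_image K I `<=` circle_image K (a, b) ->
  exists m : int, [/\ I.2 = b + m%:~R, a + m%:~R <= I.1 &
                      discontinuities p I.2].
Proof.
case: I => c d avoid rem; have [[/= Kc Kd cd] _] := rem.
move=> sub.
have in_arc x (Kx : K x) : c <= x -> x < d ->
    exists m : int, a <= x + m%:~R < b.
  move=> cx xd; pose y : K := SigSub (mem_set Kx).
  apply/(circle_imageP (a, b) y Kper)/sub/circle_imageP => //.
  by exists 0; rewrite /= addr0 cx.
have [m mab] := in_arc c Kc (lexx c) cd; have /andP[acm cmb] := mab.
have [/= disc|/= disc] := removable_discontinuity rem.
  by case: (avoid _ m disc).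
have db : d <= b - m%:~R.
  rewrite leNgt; apply/negP => bd.
  have Kbm : K (b - m%:~R) by rewrite -mulrNz; exact: Kper.
  have [|n /andP[an nb]] := in_arc _ Kbm _ bd; first by lra.
  have : (n - m)%:~R < 0 :> R by rewrite intrB; lra.
  have : m <= n by apply: (@le_of_intr_sub_lt1 R); move: ba1; lra.
  by rewrite ltrz0; lia.
exists (- m); rewrite mulrNz; split=> //; last by lra.
(* If d lay strictly between the translates of a and b, p would be continuous
   there. *)
apply/eqP; rewrite eq_le db /= leNgt; apply/negP => dltb.
by apply: (avoid d m disc); apply/andP; split; lra.
Qed.

(** All the intervals of a tuple end at translates of b, so the images of any
    two of them would overlap just before b. The single interval must then cover
    the point a of the arc, which determines its left endpoint. *)
Lemma E_index_arc (p : R -> int) (s : seq (R * R)) :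
  avoids_translates a b (discontinuities p) ->
  E_index (circle_image K (a, b)) p s ->
  exists2 m : int, s = [:: (a + m%:~R, b + m%:~R)] &
                   discontinuities p (b + m%:~R).
Proof.
move=> avoid [s_gt0 rem _ _ [triv cover]].
have sub i : (i < size s)%N ->
    circle_image K (nth (0, 0) s i) `<=` circle_image K (a, b).
  by move=> si x Jx; rewrite -cover; exists i.
have shape i : (i < size s)%N -> exists m : int,
    [/\ (nth (0, 0) s i).2 = b + m%:~R, a + m%:~R <= (nth (0, 0) s i).1,
        discontinuities p (nth (0, 0) s i).2 &
        Kinterval K (nth (0, 0) s i)].
  move=> si; have remi := rem _ (mem_nth (0, 0) si).
  have [m [? ? ?]] := removable_in_arc avoid remi (sub i si).
  by exists m; split=> //; case: remi.
have size1 : size s = 1%N.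
  apply/eqP; rewrite eqn_leq s_gt0 andbT leqNgt; apply/negP => s_gt1.
  have [m [I2 I1 _ [KI _ I12]]] := shape 0%N (ltnW s_gt1).
  have [n [J2 J1 _ [KJ _ J12]]] := shape 1%N s_gt1.
  set I := nth _ _ 0 in I2 I1 KI I12 *; set J := nth _ _ 1 in J2 J1 KJ J12 *.
  suff : (0 = 1)%N by [].
  apply: (triv _ _ s_gt0 s_gt1).
  (* A common point of the images: the later of the two left ends, after
     translation to the interval from a to b. *)
  pose x := Num.max (I.1 - m%:~R) (J.1 - n%:~R).
  have Kx : K x.
    by rewrite /x maxEle; case: ifP => _; rewrite -mulrNz; exact: Kper.
  have xI : I.1 - m%:~R <= x by rewrite le_max lexx.
  have xJ : J.1 - n%:~R <= x by rewrite le_max lexx orbT.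
  have xb : x < b by rewrite gt_max; apply/andP; split; lra.
  exists (circle_proj (SigSub (mem_set Kx) : K)).
  split; apply/circle_imageP => //=; [exists m|exists n];
    by apply/andP; split; lra.
case: s size1 cover shape {s_gt0 rem triv sub} => [|[c d] []] // _ cover.
move=> /(_ 0%N isT)[m /= [dE ac disc _]].
have [n /andP[cn nd]] : exists n : int, c <= a + n%:~R < d.
  pose x : K := SigSub (mem_set Ka).
  apply/(circle_imageP (c, d) x Kper).
  have : circle_image K (a, b) (circle_proj x).
    by apply/circle_imageP => //; exists 0; rewrite /= addr0 lexx.
  by rewrite -cover => -[[|//] _].
have mn : m = n.
  apply/eqP; rewrite eq_le; apply/andP; split;
    by apply: (@le_of_intr_sub_lt1 R); move: ba1; lra.
exists m; rewrite -?dE //; congr [:: (_, _)].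
by move: cn; rewrite -mn; lra.
Qed.

Lemma E_index_arc1 (p : R -> int) :
  removable K (a, b) p -> E_index (circle_image K (a, b)) p [:: (a, b)].
Proof.
move=> rem; split=> //=; first by move=> I; rewrite inE => /eqP ->.
split; first by move=> [|i] [|j].
apply/seteqP; split=> x; first by case=> -[|].
by exists 0%N.
Qed.

Lemma finite_E_index (p : R -> int) :
  avoids_translates a b (discontinuities p) -> finite_set (discontinuities p) ->
  finite_set (E_index (circle_image K (a, b)) p).
Proof.
move=> avoid fin; apply: sub_finite_set
  (finite_image (fun d => [:: (d - (b - a), d)]) fin).
move=> s /(E_index_arc avoid)[m -> disc]; exists (b + m%:~R) => //=.
by congr [:: (_, _)]; lra.
Qed.

(** At c = a + m neither p nor p' jumps, and if m were nonzero the interval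
    [a, b[ would stay away from c, as b - a < 1. The function removed from p is
    then the only one of the four that jumps at c, which contradicts
    the equality. *)
Lemma removed_arc_inj (p p' : R -> int) (m : int) :
  avoids_translates a b (discontinuities p) ->
  avoids_translates a b (discontinuities p') ->
  p \- char_fun (a + m%:~R, b + m%:~R) = p' \- char_fun (a, b) -> m = 0.
Proof.
have [lt_ab lt_ba1] := (ab, ba1).
move=> avoid avoid' eqpp'; apply/eqP/negPn/negP => m0.
pose c := a + m%:~R.
have ctn (f : R -> int) : avoids_translates a b (discontinuities f) ->
    \forall t \near c, f t = f c.
  move=> av; apply/continuous_dintP; apply: contrapT => disc.
  by apply: (av c (- m) disc); rewrite /c mulrNz addrK lexx.
(* The last translate of b before c is b + (m - 1) = c - (1 - (b - a)). *)
have out t : c - (1 - (b - a)) < t -> t <= c -> char_fun (a, b) t = 0.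
  move=> ct tc; rewrite char_funE /=.
  case: (boolP (_ <= _ < _)%R) => // /andP[le_at tb].
  move: ct tc; rewrite /c => ct tc.
  exfalso; case: (ltgtP m 0) m0 => // [m_lt0|m_gt0] _.
    have : m%:~R <= (-1)%:~R :> R by rewrite ler_int; lia.
    by rewrite mulrN1z; lra.
  have : 1%:~R <= m%:~R :> R by rewrite ler_int; lia.
  by rewrite mulr1z; lra.
near c^'- => t.
have tc : t < c by near: t; exact: nbhs_left_lt.
have ct : c - (1 - (b - a)) < t by near: t; apply: nbhs_left_gt; lra.
have pt : p t = p c by near: t; exact: (cvg_within _ (ctn p avoid)).
have pt' : p' t = p' c by near: t; exact: (cvg_within _ (ctn p' avoid')).
have := congr1 (fun f => f c) eqpp'; have := congr1 (fun f => f t) eqpp'.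
rewrite /= (out t ct (ltW tc)) (out c) //; last by lra.
rewrite !char_funE /= pt pt' lexx (lt_geF tc) ltrD2r ab /=.
by lia.
Unshelve. all: by end_near. Qed.

End Arc.

(** * Choice of the arc *)

Lemma near_avoids_translate (R : realType) (b x : R) :
  \forall a \near b^'-, forall m : int, ~ a <= x + m%:~R < b.
Proof.
(* The last translate of x strictly before b. *)
pose n := Num.ceil (b - x) - 1.
have nb : x + n%:~R < b.
  by rewrite -ltrBrDl; exact: (ceilB1_lt (b - x)).
near=> a.
have xna : x + n%:~R < a by near: a; exact: nbhs_left_gt.
move=> m /andP[am mb].
have : m%:~R <= n%:~R :> R.
  rewrite ler_int /n; suff : m < Num.ceil (b - x) by lia.
  by rewrite -(ltr_int R); apply: lt_le_trans (ceil_ge _); rewrite ltrBrDl.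
by lra.
Unshelve. all: by end_near. Qed.

Lemma near_avoids_translates (R : realType) (b : R) (D : set R) :
  finite_set D -> \forall a \near b^'-, avoids_translates a b D.
Proof.
move=> /finite_seqP[s ->].
elim: s => [|x s IH]; first by near=> a => y m.
near=> a => y m /=; rewrite inE => /predU1P[->|ys].
  by move: m; near: a; exact: near_avoids_translate.
have av : avoids_translates a b [set` s] by near: a.
exact: av.
Unshelve. all: by end_near. Qed.

(** * Coefficients in the Fock space *)

Lemma mcoeff_scale (R : realType) (K : set R) (q : pyramid K) (c : baseF)
    (v : Fock K) : monalg.mcoeff q (c *: v) = c * monalg.mcoeff q v.
Proof. exact: monalg.mcoeffZ. Qed.

Lemma mcoeff_ket (R : realType) (K : set R) (f : R -> int) (q : pyramid K) :
  monalg.mcoeff q (ket K f) = `[< f = \val q >]%:R.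
Proof.
rewrite /ket; case: insubP => [u _ <-|nf].
  by rewrite monalg.mcoeffU.
rewrite monalg.mcoeff0; case: asboolP => // fq.
by move: nf; rewrite fq (valP q).
Qed.

Lemma mcoeff_E_ket (R : realType) (K : set R) (J : set (circle K))
    (p : R -> int) (q : pyramid K) : finite_set (E_index J p) ->
  monalg.mcoeff q (E_ket J p) = \sum_(s \in E_index J p)
    E_coeff K p s *
      `[< p \- (fun x => \sum_(I <- s) char_fun I x) = \val q >]%:R.
Proof.
move=> fin; rewrite /E_ket !fsbig_finite //= (raddf_sum (monalg.mcoeff q)).
by apply: eq_bigr => s _; rewrite /= mcoeff_scale mcoeff_ket.
Qed.

Lemma mcoeff_E_op (R : realType) (K : set R) (J : set (circle K)) (v : Fock K)
    (q : pyramid K) :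
  monalg.mcoeff q (E_op J v) = \sum_(p <- monalg.msupp v)
    monalg.mcoeff p v * monalg.mcoeff q (E_ket J (\val p)).
Proof.
rewrite /E_op (raddf_sum (monalg.mcoeff q)).
by apply: eq_bigr => p _; rewrite /= mcoeff_scale.
Qed.

Lemma vhalf_neq0 : vhalf != 0.
Proof. by rewrite /vhalf tofrac_eq0 polyX_eq0. Qed.

Lemma E_coeff1_neq0 (R : realType) (K : set R) (p : R -> int) (I : R * R) :
  E_coeff K p [:: I] != 0.
Proof.
have vv0 : vv != 0 by rewrite expf_neq0 // vhalf_neq0.
rewrite /E_coeff /= expr1 !expr0 mul1r mulr1.
by rewrite !mulf_neq0 ?expfz_neq0 ?oppr_eq0 ?vhalf_neq0.
Qed.

Lemma char_fun_sum1 (R : realType) (I : R * R) :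
  (fun x => \sum_(J <- [:: I]) char_fun J x) = char_fun I.
Proof. by apply/funext => x; rewrite big_seq1. Qed.

(** * Noninvariance away from the vacuum *)

Definition left_dense_in_itself (R : realType) (K : set R) : Prop :=
  forall (b : R) (P : set R), K b ->
    (\forall a \near b^'-, P a) -> exists2 a, K a & P a.

(** For the arc J chosen just before the last step down of p, the pyramid p with
    this step moved back across J is reached from p only, and in one way. *)
Lemma E_op_neq0 (R : realType) (K : set R) (v : Fock K) (p : pyramid K) :
    translation_stable K -> left_dense_in_itself K ->
    p \in monalg.msupp v -> \val p <> (fun=> 0) ->
  exists2 J, strict_interval J & E_op J v <> 0.
Proof.
move=> Kper Kdense pv p_neq0.
have pyr_p : pyramid K (\val p) := set_valP p.
have [x [b [/andP[x0 xb] Kb pr p1]]] := pyramid_right_end pyr_p p_neq0.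
pose D := \bigcup_(q in [set` monalg.msupp v]) discontinuities (\val q).
have finD : finite_set D.
  apply: bigcup_finite => [|q _]; first exact: finite_fset.
  by have [[]] := set_valP q.
have [a Ka [xa ab ba1 avoid]] :
    exists2 a, K a & [/\ x < a, a < b, b - a < 1 & avoids_translates a b D].
  apply: (Kdense b) => //; near=> a; split; near: a.
  - exact: nbhs_left_gt.
  - exact: nbhs_left_lt.
  - exact: nbhs_left_ltBl.
  - exact: near_avoids_translates.
have avoids q : q \in monalg.msupp v ->
    avoids_translates a b (discontinuities (\val q)).
  by move=> qv y m qy; apply: avoid; exists q.
have pyr_q := pyramid_truncate pyr_p x0 xa ab Ka pr p1.
pose q : pyramid K := SigSub (mem_set pyr_q).
have qE : \val q = \val p \- char_fun (a, b) by [].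
exists (circle_image K (a, b)); first exact: circle_arc_strict.
set J := circle_image K (a, b).
have fin p' : p' \in monalg.msupp v -> finite_set (E_index J (\val p')).
  move=> p'v; apply: finite_E_index => //; first exact: avoids.
  by have [[]] := set_valP p'.
have term p' s : p' \in monalg.msupp v -> E_index J (\val p') s ->
    \val p' \- (fun x => \sum_(I <- s) char_fun I x) = \val q ->
    p' = p /\ s = [:: (a, b)].
  move=> p'v /(E_index_arc Kper Ka Kb ab ba1 (avoids _ p'v))[m -> _].
  rewrite char_fun_sum1 qE => eqpp'.
  have m0 := removed_arc_inj ab ba1 (avoids _ p'v) (avoids _ pv) eqpp'.
  move: eqpp'; rewrite m0 !addr0 => eqpp'; split=> //; apply: val_inj.
  by apply/funext => y; have := congr1 (fun f => f y) eqpp' => /= /addIr.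
suff : monalg.mcoeff q (E_op J v) != 0.
  by move=> + E0; rewrite E0 monalg.mcoeff0 eqxx.
rewrite mcoeff_E_op (bigD1_seq p) ?fset_uniq //= big_seq_cond big1 ?addr0.
  apply: mulf_neq0; first by rewrite monalg.mcoeff_neq0.
  rewrite mcoeff_E_ket; last exact: fin.
  have abE : E_index J (\val p) [:: (a, b)].
    by apply: E_index_arc1; split; [split|exact: pyr_q].
  rewrite (fsbigD1 [:: (a, b)]) //=; last exact: fin.
  rewrite fsbig1 => [|s [sE /= s_neq]].
    rewrite addr0 char_fun_sum1 asboolT // mulr1.
    exact: E_coeff1_neq0.
  by case: asboolP => [/(term p s pv sE)[_ //]|_]; rewrite mulr0.
move=> p' /andP[p'v p'p]; rewrite mcoeff_E_ket; last exact: fin.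
rewrite fsbig1 ?mulr0 // => s sE.
case: asboolP => [/(term p' s p'v sE)[p'E _]|_]; last by rewrite mulr0.
by rewrite p'E eqxx in p'p.
Unshelve. all: by end_near. Qed.

Lemma near_left_rational (R : realType) (b : R) (P : set R) :
  (\forall a \near b^'-, P a) -> exists r : rat, P (b - ratr r).
Proof.
move=> /nbhs_left0P Pb; have [e /= e0 eP] := Pb.
have [r /andP[r0 re]] := rat_in_itvoo e0.
exists r; apply: eP => //=.
by rewrite sub0r normrN gtr0_norm.
Qed.

Theorem proposition6p4 (R : realType) (K : set R)
    (hK : K = range (@ratr R) \/ K = [set: R]) :
  Uplus_invariants K = [set c *: ket K (fun=> 0) | c in [set: baseF]].
Proof.
have Kper : translation_stable K.
  move=> x m; case: hK => -> // -[r _ <-].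
  by exists (r + m%:~R); rewrite // rmorphD /= ratr_int.
have Kdense : left_dense_in_itself K.
  move=> b P Kb /near_left_rational[r Pr]; exists (b - ratr r) => //.
  case: hK Kb => -> // -[r' _ <-].
  by exists (r' - r); rewrite // rmorphB.
have zero_pyr : pyramid K (fun=> 0) := pyramid0 K.
pose z : pyramid K := SigSub (mem_set zero_pyr).
apply/seteqP; split=> [v inv|_ [c _ <-] J _].
  exists (monalg.mcoeff z v) => //; apply/monalg.malgP => p.
  rewrite mcoeff_scale mcoeff_ket; case: asboolP => [pz|p_neq0].
    by rewrite mulr1; congr (monalg.mcoeff _ v); exact: val_inj.
  rewrite mulr0; apply/esym/eqP/negPn/negP; rewrite monalg.mcoeff_neq0 => pv.
  have [|J strJ] := E_op_neq0 Kper Kdense pv; first by move=> /esym.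
  by apply; exact: inv.
apply/monalg.malgP => q; rewrite mcoeff_E_op monalg.mcoeff0.
rewrite big_seq big1 // => p.
rewrite -monalg.mcoeff_neq0 mcoeff_scale mcoeff_ket.
case: asboolP => [pz _|_]; last by rewrite mulr0 eqxx.
have -> : E_ket J (\val p) = 0.
  rewrite -pz /E_ket.
  suff -> : E_index J (fun=> 0) = set0 by rewrite fsbig_set0.
  apply/seteqP; split=> // -[|I s] [] // _.
  move=> /(_ I (mem_head _ _))[[_ _ I12]] [_ ge0 _ _ _].
  by have := ge0 I.1; rewrite /= char_funE lexx I12.
by rewrite monalg.mcoeff0 mulr0.
Qed.
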